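(* Let $x^{\ast}\in\mathbb{R}^2$ be a solution of the weighted Weber problem, i.e. $\sum_{j=2}^J\rho_j d_j(x^{\ast})=\min_{x\in\mathbb{R}^2}\sum_{j=2}^J\rho_j d_j(x)$. Then for every $N\ge 1$ the overall expected passage time (round-trip time) $Z(N;x)$ attains its minimum over $x\in\mathbb{R}^2$ at $x^{\ast}$: $Z(N;x^{\ast})=\min_{x\in\mathbb{R}^2}Z(N;x)$.
   Context: Data: an integer $J\ge 2$; warehouses $j=2,\dots,J$ with locations $a_j\in\mathbb{R}^2$ and demands $D_j>0$; $D=\sum_{j=2}^J D_j$, $\rho_j=D_j/D$ (so $\sum_{j=2}^J\rho_j=1$); a convex function $d:\mathbb{R}^2\times\mathbb{R}^2\to[0,\infty)$, and $d_j(x):=d(a_j,x)$; for $j=1,\dots,J$ an integer $s_j\ge 1$ and a real $\mu_j>0$, with $\mu_j(n):=\mu_j\min(n,s_j)$, $n\in\mathbb{N}$. Node $1$ is the production center, located at $x\in\mathbb{R}^2$. Network: for $N\ge1$ and $x\in\mathbb{R}^2$, $N$ trucks circulate in a closed queueing network (Gordon–Newell network) with node set $\bar J=\{1,2,\dots,J,2a,\dots,Ja,2b,\dots,Jb\}$. Node $j\in\{1,\dots,J\}$ is a first-come-first-served exponential station with total service rate $\mu_j(n_j)$ when $n_j$ trucks are present. Nodes $ja$ and $jb$ ($j=2,\dots,J$) are infinite-server stations with exponential service times (travel times) of mean $d_j(x)$, i.e. total rates $n/d_j(x)$. All service times and routing decisions are independent. Routing: $r(1,ja)=\rho_j$, $r(ja,j)=r(j,jb)=r(jb,1)=1$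 for $j=2,\dots,J$, all other $r(k,m)=0$. Thus the queue length vector is a continuous-time Markov chain on $S(N,\bar J)=\{(n_i)_{i\in\bar J}\in\mathbb{N}^{\bar J}:\sum_i n_i=N\}$ which jumps from $n$ to $n-e_i+e_k$ (for $n_i\ge1$) at rate (total service rate of node $i$ at $n_i$) $\cdot\, r(i,k)$. The system is considered in its unique stationary regime. (If $d_j(x)=0$, travel on $ja,jb$ is instantaneous, and $n_{ja}=n_{jb}=0$ always.) Passage times: $W_i(N;x)$ is the stationary expected sojourn time (waiting plus service) of a truck per visit to node $i\in\bar J$; by Little's theorem, $W_i(N;x)$ is the stationary mean number of trucks at $i$ divided by the stationary mean number of departures per time unit from $i$. For $j=2,\dots,J$, $Z_j(N;x)=W_{ja}(N;x)+W_j(N;x)+W_{jb}(N;x)+W_1(N;x)$, and $Z(N;x)=\sum_{j=2}^J r(1,ja)Z_j(N;x)=\sum_{j=2}^J\rho_jZ_j(N;x)$. *)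

(* Defs.v *)
From HB Require Import structures.
From mathcomp Require Import all_boot all_order all_algebra.
From mathcomp Require Import boolp classical_sets reals convex.

Set Implicit Arguments.
Unset Strict Implicit.
Unset Printing Implicit Defensive.

Import Order.TTheory GRing.Theory Num.Theory.
Local Open Scope ring_scope.

(* There are K = J - 1 warehouses.  [Station ord0] is the production center
   (node 1), [Station (lift ord0 j)] is warehouse j; [Out j] and [Back j] are
   the infinite-server travel nodes "ja" (center to warehouse) and "jb"
   (warehouse to center). *)
Inductive node (K : nat) : Type :=
  | Station of 'I_K.+1
  | Out of 'I_K
  | Back of 'I_K.
Arguments Station {K} i.
Arguments Out {K} j.
Arguments Back {K} j.

Section NodeFinType.
Variable K : nat.

Definition node_code (i : node K) : 'I_K.+1 + ('I_K + 'I_K) :=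
  match i with
  | Station k => inl k
  | Out j => inr (inl j)
  | Back j => inr (inr j)
  end.

Definition node_decode (c : 'I_K.+1 + ('I_K + 'I_K)) : node K :=
  match c with
  | inl k => Station k
  | inr (inl j) => Out j
  | inr (inr j) => Back j
  end.

Lemma node_codeK : cancel node_code node_decode.
Proof. by case. Qed.

HB.instance Definition _ := Finite.copy (node K) (can_type node_codeK).

End NodeFinType.

Definition center {K : nat} : node K := Station ord0.
Definition warehouse {K : nat} (j : 'I_K) : node K := Station (lift ord0 j).

(* Population vectors of total N; the bound 'I_N.+1 on the coordinates is
   implied by the total and only serves to make the type finite. *)
Definition state (K N : nat) : Type :=
  {n : {ffun node K -> 'I_N.+1} | (\sum_i (n i : nat) == N)%N}.

Definition pop {K N : nat} (n : state K N) (i : node K) : nat := val n i.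

Section Network.
Variables (R : realType) (K : nat).
(* tau j is the mean travel time on each of the nodes Out j and Back j. *)
Variables (mu : 'I_K.+1 -> R) (s : 'I_K.+1 -> nat) (rho tau : 'I_K -> R).

Definition instantaneous (i : node K) : bool :=
  match i with
  | Station _ => false
  | Out j | Back j => tau j == 0
  end.

Definition service_rate (i : node K) (n : nat) : R :=
  match i with
  | Station k => mu k * (minn n (s k))%:R
  | Out j | Back j => n%:R / tau j
  end.

Definition routing (i k : node K) : R :=
  match i, k with
  | Station _, Out j => if i == center then rho j else 0
  | Station _, Back j => (i == warehouse j)%:R
  | Out j, Station _ => (k == warehouse j)%:R
  | Back _, Station _ => (k == center)%:R
  | _, _ => 0
  end.

(* A truck routed to an instantaneous node leaves it at once.  The successor
   of a travel node is a station, so at most one node is skipped per jump. *)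
Definition eff_routing (i k : node K) : R :=
  if instantaneous k then 0
  else routing i k + \sum_(l | instantaneous l) routing i l * routing l k.

Section Population.
Variable N : nat.
Implicit Types n m : state K N.

(* m = n - e_i + e_k with n_i >= 1, written without truncated subtraction *)
Definition is_move n m (i k : node K) : bool :=
  (0 < pop n i)%N &&
  [forall l, (pop m l + (l == i) == pop n l + (l == k))%N].

Definition jump_rate n m : R :=
  \sum_i \sum_(k | is_move n m i k) service_rate i (pop n i) * eff_routing i k.

(* Invariant distributions of the chain (global balance); instantaneous nodes
   are always empty. *)
Definition stationary (p : {ffun state K N -> R}) : Prop :=
  [/\ forall n, 0 <= p n,
      \sum_n p n = 1,
      forall n i, instantaneous i -> (0 < pop n i)%N -> p n = 0
    & forall n, p n * (\sum_m jump_rate n m) = \sum_m p m * jump_rate m n].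

(* The default value 0 would be used only if there were no stationary
   distribution. *)
Definition stat_dist : {ffun state K N -> R} :=
  xget [ffun=> 0] [set p | stationary p]%classic.

Definition mean_pop (i : node K) : R :=
  \sum_n stat_dist n * (pop n i)%:R.

Definition mean_service (i : node K) : R :=
  \sum_n stat_dist n * service_rate i (pop n i).

(* Mean number of departures per time unit.  What leaves an instantaneous node
   is what enters it, and it is entered only from stations. *)
Definition departure_rate (i : node K) : R :=
  if instantaneous i then \sum_(k | ~~ instantaneous k) mean_service k * routing k i
  else mean_service i.

(* Little's theorem *)
Definition sojourn (i : node K) : R := mean_pop i / departure_rate i.

Definition passage_via (j : 'I_K) : R :=
  sojourn (Out j) + sojourn (warehouse j) + sojourn (Back j) + sojourn center.

Definition passage_time : R := \sum_j routing center (Out j) * passage_via j.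

End Population.
End Network.

Section Location.
Variables (R : realType) (K : nat).
Variables (D : 'I_K -> R) (a : 'I_K -> 'rV[R]_2).
Variable d : 'rV[R]_2 -> 'rV[R]_2 -> R.

Definition demand_share (j : 'I_K) : R := D j / \sum_i D i.

Definition weber_cost (x : 'rV[R]_2) : R :=
  \sum_j demand_share j * d (a j) x.

Definition overall_passage_time (mu : 'I_K.+1 -> R) (s : 'I_K.+1 -> nat)
    (N : nat) (x : 'rV[R]_2) : R :=
  passage_time mu s demand_share (fun j => d (a j) x) N.

End Location.

(* Main.v *)
Require Import Defs.
From mathcomp Require Import all_boot all_order all_algebra.
From mathcomp Require Import boolp classical_sets reals convex.
From mathcomp Require Import ring lra zify.
Import Order.TTheory GRing.Theory Num.Theory.
Local Open Scope ring_scope.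

Set Implicit Arguments.
Unset Strict Implicit.
Unset Printing Implicit Defensive.

(** The stationary law has product form, so by Little's theorem
    Z(N; x) = N G(N) / G(N - 1), where G is the partition function.  Its
    generating series is the product over the nodes of the series of node
    weights, and the travel nodes contribute only exponentials, whose product
    is exp (2 w X) with w = sum_j rho_j d_j(x).  Hence Z depends on x only
    through w.  All factors have log-concave coefficients, thus so does G, and
    raising w by h convolves G with the coefficients of exp (2 h X).
    Log-concavity says that G(k) / G(k - 1) is nonincreasing in k, so the
    convolution increases G(N) / G(N - 1). *)

(** * Log-concave polynomials *)

Section LogConcave.
Variable R : realFieldType.
Implicit Types P Q : {poly R}.

(* Quantifying over a <= b, and not only a = b, excludes internal zeros, as
   closure under products requires. *)
Definition log_concave P : Prop :=
  (forall k, 0 <= P`_k) /\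
  (forall a b, (a <= b)%N -> P`_a * P`_b.+1 <= P`_a.+1 * P`_b).

(** Induction on [t]: log-concavity at [(a, b + t)] moves one unit from the larger index to the
    smaller, until [t] is used up or [a = b], where both sides agree. *)
Lemma log_concave_spread P a b t : log_concave P -> (a <= b)%N ->
  P`_a * P`_(b + t) <= P`_(a + t) * P`_b.
Proof.
case=> P0 lc; elim: t a => [|t IHt] a leab; first by rewrite !addn0.
have [<-|neab] := eqVneq a b; first by rewrite mulrC.
rewrite addnS; apply: (le_trans (lc a (b + t)%N _)).
  by rewrite (leq_trans leab) ?leq_addr.
by rewrite addnS -addSn; apply: IHt; rewrite ltn_neqAle neab.
Qed.

(** Padding with zeros lets convolutions of different lengths share one index range. *)
Lemma coefM_widen P Q (x M : nat) : (x < M)%N ->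
  (P * Q)`_x = \sum_(k < M) (if (k <= x)%N then P`_(x - k) else 0) * Q`_k.
Proof.
move=> xM; rewrite coefMr -(subnKC xM) big_split_ord /=.
rewrite [X in _ + X]big1 ?addr0 => [|k _]; last first.
  by rewrite leqNgt leq_addr mul0r.
by apply: eq_bigr => k _; rewrite -ltnS ltn_ord.
Qed.

(** Cauchy-Binet: the 2x2 minor of coefficients of [P * Q] is a sum of products of a Toeplitz minor
    of [P] by a minor of [Q] against its shift. *)
Lemma log_concaveM P Q :
  log_concave P -> log_concave Q -> log_concave (P * Q).
Proof.
move=> lcP lcQ; have [P0 _] := lcP; have [Q0 lQ] := lcQ.
split=> [k|a b leab].
  by rewrite coefM; apply: sumr_ge0 => i _; rewrite mulr_ge0.
pose F x k : R := if (k <= x)%N then P`_(x - k) else 0.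
have F0 x k : 0 <= F x k by rewrite /F; case: ifP.
have FF k l : (k <= l)%N -> F a.+1 l * F b.+1 k <= F a.+1 k * F b.+1 l.
  move=> kl; rewrite {1}/F; case: ifP => la; last by rewrite mul0r mulr_ge0.
  have lb : (l <= b.+1)%N by lia.
  rewrite /F lb !(leq_trans kl) //.
  have := @log_concave_spread P (a.+1 - l) (b.+1 - l) (l - k) lcP.
  have -> : (b.+1 - l + (l - k) = b.+1 - k)%N by lia.
  have -> : (a.+1 - l + (l - k) = a.+1 - k)%N by lia.
  by apply; lia.
(* The shift turns coefficient [x] of [P * Q] into coefficient [x.+1] of [P * ('X * Q)], so all four
   entries use the same two rows [F a.+1] and [F b.+1]. *)
pose g k := ('X * Q)`_k.
have gE k : g k = if k is k'.+1 then Q`_k' else 0 by rewrite /g coefXM; case: k.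
have gg k l : (k <= l)%N -> g k * Q`_l <= Q`_k * g l.
  rewrite !gE; case: k => [|k]; first by rewrite mul0r mulr_ge0 //; case: l.
  by case: l => // l kl; exact: lQ.
have hS x : (x <= b)%N -> (P * Q)`_x.+1 = \sum_(k < b.+2) F x.+1 k * Q`_k.
  by move=> xb; rewrite (@coefM_widen _ _ _ b.+2).
have h0 x : (x <= b)%N -> (P * Q)`_x = \sum_(k < b.+2) F x.+1 k * g k.
  move=> xb; rewrite -(@coefM_widen _ _ _ b.+2) //.
  by rewrite mulrCA coefXM.
rewrite !hS // !h0 // -subr_ge0 !big_distrlr /= -sumrB.
set S := (X in 0 <= X).
pose T (k l : 'I_b.+2) := F a.+1 k * F b.+1 l * (Q`_k * g l - g k * Q`_l).
have ST : S = \sum_k \sum_l T k l.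
  apply: eq_bigr => k _; rewrite -sumrB; apply: eq_bigr => l _; rewrite /T; ring.
(* symmetrising in (k, l) turns each term into a product of two minors *)
have : S + S = \sum_k \sum_l (T k l + T l k).
  rewrite {2}ST exchange_big /= ST -big_split /=.
  by apply: eq_bigr => k _; rewrite -big_split.
suff : 0 <= \sum_k \sum_l (T k l + T l k) by move=> + E; rewrite -E; lra.
apply: sumr_ge0 => k _; apply: sumr_ge0 => l _.
have -> : T k l + T l k = (F a.+1 k * F b.+1 l - F a.+1 l * F b.+1 k) *
                          (Q`_k * g l - g k * Q`_l) by rewrite /T; ring.
(* Both minors are nonnegative if [k <= l] and nonpositive otherwise. *)
have [kl|lk] := leqP k l.
  by rewrite mulr_ge0 // subr_ge0 ?FF ?gg.
rewrite mulr_le0 // subr_le0; first exact/FF/ltnW.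
by have := gg _ _ (ltnW lk); rewrite mulrC [g k * _]mulrC.
Qed.

Lemma log_concave1 : log_concave 1.
Proof.
by split=> [k|a b _]; rewrite !coef1 /= ?mulr0 ?mulr_ge0 // ?ler0n.
Qed.

Lemma log_concave_prod (I : Type) (r : seq I) (F : I -> {poly R}) :
  (forall i, log_concave (F i)) -> log_concave (\prod_(i <- r) F i).
Proof.
move=> lcF; elim/big_ind: _ => // [|P Q]; [exact: log_concave1|exact: log_concaveM].
Qed.

(** Successive coefficients have ratio [u k], nonincreasing in [k]. Truncation is harmless: if
    [b.+1 < M] all four indices are below [M], and otherwise the left side is 0. *)
Lemma log_concave_poly_prod M (u : nat -> R) :
  (forall k, 0 <= u k) -> (forall a b, (a <= b)%N -> u b <= u a) ->
  log_concave (\poly_(k < M) \prod_(i < k) u i).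
Proof.
move=> u0 uN; have p0 k : 0 <= \prod_(i < k) u i by apply: prodr_ge0.
split=> [k|a b leab]; rewrite !coef_poly; first by case: ifP.
case: ifP => aM; last by rewrite mul0r mulr_ge0 //; case: ifP.
case: ifP => bM; last by rewrite mulr0 mulr_ge0 //; case: ifP.
rewrite (leq_ltn_trans (_ : a < b.+1)%N bM) // (ltnW bM).
rewrite !big_ord_recr /=.
have := ler_wpM2l (mulr_ge0 (p0 a) (p0 b)) (uN _ _ leab).
by congr (_ <= _); ring.
Qed.

End LogConcave.

(** * Congruence of polynomials modulo ['X^M], in place of formal power series *)

Section EqUpto.
Variable R : comNzRingType.
Implicit Types P Q : {poly R}.

Definition eq_upto M P Q : Prop := forall k, (k < M)%N -> P`_k = Q`_k.

Lemma eq_upto_refl M P : eq_upto M P P. Proof. by []. Qed.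

Lemma eq_upto_trans M P Q S : eq_upto M P Q -> eq_upto M Q S -> eq_upto M P S.
Proof. by move=> h1 h2 k kM; rewrite h1 ?h2. Qed.

Lemma eq_uptoM M P P' Q Q' :
  eq_upto M P P' -> eq_upto M Q Q' -> eq_upto M (P * Q) (P' * Q').
Proof.
move=> hP hQ k kM; rewrite !coefM; apply: eq_bigr => i _.
by rewrite hP ?hQ // (leq_ltn_trans _ kM) ?leq_subr // -ltnS.
Qed.

Lemma eq_upto_prod M (I : Type) (r : seq I) (F F' : I -> {poly R}) :
  (forall i, eq_upto M (F i) (F' i)) ->
  eq_upto M (\prod_(i <- r) F i) (\prod_(i <- r) F' i).
Proof.
move=> h; elim/big_ind2: _ => // P Q P' Q'; exact: eq_uptoM.
Qed.

End EqUpto.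

(** * Truncated exponential series *)

Section Exponential.
Variable R : realFieldType.

Definition exp_poly (M : nat) (x : R) : {poly R} :=
  \poly_(k < M) (x ^+ k / k`!%:R).

(** The binomial theorem, coefficient by coefficient below [M]. *)
Lemma exp_polyD M x y :
  eq_upto M (exp_poly M x * exp_poly M y) (exp_poly M (x + y)).
Proof.
move=> k kM; rewrite coefM coef_poly kM addrC exprDn mulr_suml.
apply: eq_bigr => i _; have ik : (i <= k)%N by rewrite -ltnS.
rewrite !coef_poly (leq_ltn_trans ik kM) (leq_ltn_trans (leq_subr _ _) kM).
rewrite -mulr_natr -[in k`!](bin_fact ik) !natrM.
have f0 n : n`!%:R != 0 :> R by rewrite pnatr_eq0 -lt0n fact_gt0.
have b0 : 'C(k, i)%:R != 0 :> R by rewrite pnatr_eq0 -lt0n bin_gt0.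
by field; rewrite !f0.
Qed.

Lemma exp_poly0 M : eq_upto M (exp_poly M 0) 1.
Proof.
move=> k kM; rewrite coef_poly kM coef1 expr0n; case: k {kM} => [|k].
  by rewrite divr1.
by rewrite mul0r.
Qed.

Lemma exp_poly_prod M (I : Type) (r : seq I) (F : I -> R) :
  eq_upto M (\prod_(i <- r) exp_poly M (F i)) (exp_poly M (\sum_(i <- r) F i)).
Proof.
elim: r => [|i r IHr].
  by rewrite !big_nil => k kM; rewrite exp_poly0.
rewrite !big_cons; apply: eq_upto_trans (@exp_polyD _ _ _).
exact: eq_uptoM.
Qed.

Lemma exp_poly_log_concave M x : 0 <= x -> log_concave (exp_poly M x).
Proof.
move=> x0; have -> : exp_poly M x = \poly_(k < M) \prod_(i < k) (x / i.+1%:R).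
  apply/polyP => k; rewrite !coef_poly; case: ifP => // _.
  rewrite big_split /= prodr_const card_ord; congr (_ * _).
  by rewrite fact_prod big_add1 big_mkord natr_prod -prodfV.
apply: (@log_concave_poly_prod _ M (fun i => x / i.+1%:R)) => [k|a b ab].
  by rewrite divr_ge0.
by rewrite ler_wpM2l // lef_pV2 ?posrE ?ltr0n // ler_nat.
Qed.

(** Cross-multiplied, so that no coefficient has to be nonzero. Expanding the convolution with
    [exp_poly M (y - x)], the inequality holds term by term by log-concavity of [S] at the indices
    [n - k <= n]. *)
Lemma exp_poly_ratio_mono (Q : {poly R}) M n x y :
  log_concave Q -> (n.+1 < M)%N -> 0 <= x -> x <= y ->
  (Q * exp_poly M y)`_n * (Q * exp_poly M x)`_n.+1 <=
  (Q * exp_poly M y)`_n.+1 * (Q * exp_poly M x)`_n.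
Proof.
move=> lcQ nM x0 xy; set S := Q * exp_poly M x.
have lcS : log_concave S by apply: log_concaveM => //; exact: exp_poly_log_concave.
have E : eq_upto M (Q * exp_poly M y) (S * exp_poly M (y - x)).
  rewrite /S -mulrA; apply: eq_uptoM => // k kM.
  by rewrite exp_polyD // addrC subrK.
clearbody S; rewrite !E // 1?ltnW // !coefMr [X in _ <= X * _]big_ord_recr /= subnn.
have [S0 lS] := lcS.
have e0 k : 0 <= (exp_poly M (y - x))`_k.
  by have [] := @exp_poly_log_concave M (y - x); rewrite ?subr_ge0.
(* The convolution for [n.+1] has one more term than that for [n]; it is nonnegative and is
   dropped. *)
rewrite mulrDl; apply: ler_wpDr; first by rewrite !mulr_ge0 ?e0 ?S0.
rewrite !mulr_suml; apply: ler_sum => k _.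
have kn : (k <= n)%N by rewrite -ltnS.
by rewrite mulrAC [leRHS]mulrAC ler_wpM2r // subSn // lS // leq_subr.
Qed.

End Exponential.

(** * Population vectors *)

(** Expanding the product picks one power of ['X] per node, that is a population vector; the
    coefficient of ['X^N] selects those of total [N]. *)
Lemma sum_state_coef (R : comNzRingType) (K N : nat) (psi : node K -> nat -> R)
    (P : node K -> {poly R}) :
  (forall i k, (k <= N)%N -> (P i)`_k = psi i k) ->
  \sum_(n : state K N) \prod_i psi i (pop n i) = (\prod_i P i)`_N.
Proof.
(* Truncating at degree [N] makes distributivity range over exactly the functions into ['I_N.+1]
   that underlie [state K N]. *)
move=> PE; have -> : (\prod_i P i)`_N = (\prod_i \poly_(k < N.+1) psi i k)`_N.
  apply: (@eq_upto_prod _ N.+1) => // i k kN.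
  by rewrite coef_poly kN PE.
under eq_bigr do rewrite poly_def.
rewrite bigA_distr_bigA coef_sum /=.
rewrite [RHS](eq_bigr (fun f : {ffun node K -> 'I_N.+1} =>
   if (\sum_i (f i : nat) == N)%N then \prod_i psi i (f i) else 0)); last first.
  move=> f _; rewrite scaler_prod prodrXr coefZ coefXn eq_sym.
  by case: eqP; rewrite ?mulr1 ?mulr0.
rewrite -big_mkcond /=.
exact/esym/(@big_sub _ _ _ _
  [pred f : {ffun node K -> 'I_N.+1} | (\sum_i (f i : nat) == N)%N]).
Qed.

Section States.
Variables K N : nat.
Implicit Types n m : state K N.

Lemma sum_pop n : (\sum_i pop n i = N)%N.
Proof. exact/eqP/(valP n). Qed.

Lemma pop_inj n m : (forall i, pop n i = pop m i) -> n = m.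
Proof. by move=> h; apply/val_inj/ffunP => i; apply/val_inj/h. Qed.

Lemma state_of_pop (g : node K -> nat) : (\sum_i g i = N)%N ->
  exists n : state K N, forall i, pop n i = g i.
Proof.
move=> gN; have gb i : (g i < N.+1)%N by rewrite ltnS -gN (bigD1 i) //= leq_addr.
have h : (\sum_i ([ffun i => Ordinal (gb i)] i : nat) == N)%N.
  by apply/eqP; rewrite -[RHS]gN; apply: eq_bigr => i _; rewrite ffunE.
by exists (exist _ [ffun i => Ordinal (gb i)] h) => i; rewrite /pop /= ffunE.
Qed.

Lemma is_moveP n m i k :
  reflect ((0 < pop n i)%N /\
           forall l, (pop m l + (l == i) = pop n l + (l == k))%N)
          (is_move n m i k).
Proof.
by apply: (iffP andP) => -[ni h]; split=> //; [move=> l; exact/eqP/(forallP h)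
  |apply/forallP => l; exact/eqP].
Qed.

Lemma is_move_sym n m i k : is_move n m i k = is_move m n k i.
Proof.
suff h n' m' i' k' : is_move n' m' i' k' -> is_move m' n' k' i'.
  by apply/idP/idP; exact: h.
move=> /is_moveP[ni h]; apply/is_moveP; split=> [|l]; last by rewrite h.
have := h k'; rewrite eqxx; case: eqP => [->|_]; last by rewrite addn0 addn1 => ->.
by move/addIn => ->.
Qed.

Lemma is_move_exists n i k : (0 < pop n i)%N -> exists m, is_move n m i k.
Proof.
move=> ni; have [|m mE] := @state_of_pop (fun l => pop n l - (l == i) + (l == k))%N.
  rewrite big_split /= (bigD1 i) //= eqxx.
  rewrite (eq_bigr (fun l => pop n l)); last first.
    by move=> l /negbTE ->; rewrite subn0.
  rewrite [X in (_ + X)%N](bigD1 k) //= eqxx [X in (1 + X)%N]big1 => [|l /negbTE -> //].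
  by rewrite -[RHS](sum_pop n) [RHS](bigD1 i) //=; lia.
exists m; apply/is_moveP; split=> // l; rewrite mE.
by case: (eqVneq l i) => [->|_] /=; lia.
Qed.

Lemma is_move_uniq n m m' i k : is_move n m i k -> is_move n m' i k -> m = m'.
Proof.
move=> /is_moveP[_ h] /is_moveP[_ h']; apply: pop_inj => l.
by apply: (@addIn (l == i)); rewrite h h'.
Qed.

Lemma sum_is_move (R : nmodType) n i k (c : R) :
  \sum_(m | is_move n m i k) c = if (0 < pop n i)%N then c else 0.
Proof.
case: ifPn => [ni|/negbTE ni]; last first.
  by rewrite big_pred0 // => m; rewrite /is_move ni.
have [m hm] := is_move_exists k ni.
rewrite (big_pred1 m) // => m'; apply/idP/eqP => [h|->//].
exact: is_move_uniq hm.
Qed.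

Lemma all_at_center_exists :
  exists n, forall i, pop n i = if i == center then N else 0%N.
Proof. by apply: state_of_pop; rewrite -big_mkcond big_pred1_eq. Qed.

Lemma pop_center_eq n :
  (forall i, i != center -> pop n i = 0%N) -> pop n center = N.
Proof.
by move=> h; rewrite -[RHS](sum_pop n) (bigD1 center) //= big1 ?addn0.
Qed.

End States.

Lemma big_node (R : Type) (idx : R) (op : Monoid.com_law idx) K (F : node K -> R) :
  \big[op/idx]_i F i =
  op (op (\big[op/idx]_k F (Station k)) (\big[op/idx]_j F (Out j)))
     (\big[op/idx]_j F (Back j)).
Proof.
rewrite (reindex (@node_decode K)) /=; last first.
  exists (@node_code K) => [c|i] _; last exact: node_codeK.
  by case: c => [k|[j|j]].
by rewrite !big_sumType /= Monoid.mulmA.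
Qed.

(** * The product-form stationary distribution *)

Section Network.
Variables (R : realType) (K : nat).
Variables (mu : 'I_K.+1 -> R) (s : 'I_K.+1 -> nat) (rho tau : 'I_K -> R).
Hypothesis mu_gt0 : forall k, 0 < mu k.
Hypothesis s_gt0 : forall k, (0 < s k)%N.
Hypothesis rho_gt0 : forall j, 0 < rho j.
Hypothesis sum_rho : \sum_j rho j = 1.
Hypothesis tau_ge0 : forall j, 0 <= tau j.

Notation inst := (instantaneous tau).
Notation rate := (service_rate mu s tau).
Notation eff := (eff_routing rho tau).

(** Visit ratios: the solution of the traffic equations normalised to 1 at the center (see
    [traffic]). *)
Definition visit (i : node K) : R :=
  match i with
  | Station k => if unlift ord0 k is Some j then rho j else 1
  | Out j | Back j => rho j
  end.

Lemma visit_center : visit center = 1.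
Proof. by rewrite /visit /center unlift_none. Qed.

Lemma visit_warehouse j : visit (warehouse j) = rho j.
Proof. by rewrite /visit /warehouse liftK. Qed.

Lemma visit_gt0 i : 0 < visit i.
Proof. by case: i => [k|j|j] //=; case: unlift => [j|]. Qed.

Lemma rate0 i : rate i 0 = 0.
Proof. by case: i => [k|j|j] /=; rewrite ?min0n ?mulr0 ?mul0r. Qed.

(** By the convention [n / 0 = 0], an instantaneous node never triggers a jump. *)
Lemma rate_inst i n : inst i -> rate i n = 0.
Proof. by case: i => [k|j|j] //= /eqP ->; rewrite invr0 mulr0. Qed.

Lemma rate_gt0 i n : ~~ inst i -> (0 < n)%N -> 0 < rate i n.
Proof.
case: i => [k _|j|j] /= => [n0|tj n0|tj n0].
- by rewrite mulr_gt0 // ltr0n leq_min n0 s_gt0.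
- by rewrite divr_gt0 ?ltr0n // lt_neqAle eq_sym tj tau_ge0.
- by rewrite divr_gt0 ?ltr0n // lt_neqAle eq_sym tj tau_ge0.
Qed.

Lemma rate_ge0 i n : 0 <= rate i n.
Proof.
by case: i => [k|j|j] /=; rewrite ?mulr_ge0 ?ler0n ?invr_ge0 // ltW.
Qed.

(* At an instantaneous node the junk value x / 0 = 0 makes this vanish for
   n > 0, as it should. *)
Definition node_weight (i : node K) (n : nat) : R :=
  \prod_(k < n) (visit i / rate i k.+1).

Lemma node_weight0 i : node_weight i 0 = 1.
Proof. exact: big_ord0. Qed.

Lemma node_weight_ge0 i n : 0 <= node_weight i n.
Proof. by apply: prodr_ge0 => k _; rewrite divr_ge0 ?rate_ge0 ?ltW ?visit_gt0. Qed.

Lemma node_weight_gt0 i n : ~~ inst i -> 0 < node_weight i n.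
Proof. by move=> ii; apply: prodr_gt0 => k _; rewrite divr_gt0 ?rate_gt0 ?visit_gt0. Qed.

Lemma node_weight_inst i n : inst i -> (0 < n)%N -> node_weight i n = 0.
Proof.
by case: n => // n ii _; rewrite /node_weight big_ord_recr /= rate_inst // invr0 !mulr0.
Qed.

Lemma node_weightS i n : ~~ inst i ->
  node_weight i n.+1 * rate i n.+1 = visit i * node_weight i n.
Proof.
move=> ii; rewrite /node_weight big_ord_recr /= -mulrA divfK 1?mulrC //.
by rewrite gt_eqF ?rate_gt0.
Qed.

(** * Traffic equations, with instantaneous nodes eliminated *)

Lemma warehouse_eq (j j' : 'I_K) : (Station (lift ord0 j) == warehouse j') = (j == j').
Proof. by apply/eqP/eqP => [[] E|-> //]; exact/val_inj. Qed.

Lemma sum_delta (I : finType) (F : I -> R) (j : I) : \sum_i F i * (i == j)%:R = F j.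
Proof.
rewrite (bigD1 j) //= eqxx mulr1 big1 ?addr0 // => i /negbTE ->.
by rewrite mulr0.
Qed.

Lemma sum_routing i : \sum_k routing rho i k = 1.
Proof.
rewrite big_node /= big_ord_recl /=; case: i => [k|j|j] /=.
- rewrite big1_eq !add0r; case: (unliftP ord0 k) => [j|] -> /=.
    rewrite big1_eq add0r.
    rewrite (bigD1 j) //= warehouse_eq eqxx big1 ?addr0 // => i ij.
    by rewrite warehouse_eq eq_sym (negbTE ij).
  by rewrite sum_rho big1_eq addr0.
- rewrite !big1_eq !addr0 add0r.
  rewrite (bigD1 j) //= warehouse_eq eqxx big1 ?addr0 // => i ij.
  by rewrite warehouse_eq (negbTE ij).
- by rewrite !big1_eq !addr0.
Qed.

Lemma traffic k : \sum_i visit i * routing rho i k = visit k.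
Proof.
rewrite big_node /= big_ord_recl /= unlift_none.
under [X in _ + X + _ + _]eq_bigr do rewrite liftK.
case: k => [k|j|j] /=.
- under [X in _ + X + _ + _]eq_bigr do rewrite mulr0.
  rewrite mulr0 big1_eq !add0r; case: (unliftP ord0 k) => [j|] -> /=.
    under [X in _ + X]eq_bigr do rewrite mulr0.
    rewrite big1_eq addr0 -[RHS](sum_delta rho); apply: eq_bigr => i _.
    by rewrite warehouse_eq eq_sym.
  under eq_bigr do rewrite mulr0; under [X in _ + X]eq_bigr do rewrite mulr1.
  by rewrite big1_eq add0r.
- rewrite mul1r; under [X in _ + X + _ + _]eq_bigr do rewrite mulr0.
  under [X in _ + X + _]eq_bigr do rewrite mulr0.
  by under [X in _ + X]eq_bigr do rewrite mulr0; rewrite !big1_eq !addr0.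
- rewrite mulr0 add0r.
  under [X in _ + X + _]eq_bigr do rewrite mulr0.
  under [X in _ + X]eq_bigr do rewrite mulr0.
  rewrite !big1_eq !addr0 -[RHS](sum_delta rho); apply: eq_bigr => i _.
  by rewrite warehouse_eq.
Qed.

Lemma routing_ge0 i k : 0 <= routing rho i k.
Proof.
by case: i k => [i|i|i] [k|k|k] //=; rewrite ?ler0n //; case: ifP => // _; exact: ltW.
Qed.

Lemma routing_inst i k : inst i -> inst k -> routing rho i k = 0.
Proof. by case: i => [i|i|i] //; case: k. Qed.

Lemma eff_inst i k : inst k -> eff i k = 0.
Proof. by rewrite /eff_routing => ->. Qed.

Lemma eff_noninst i k : ~~ inst k -> eff i k =
  routing rho i k + \sum_(l | inst l) routing rho i l * routing rho l k.
Proof. by rewrite /eff_routing => /negbTE ->. Qed.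

Lemma eff_ge0 i k : 0 <= eff i k.
Proof.
rewrite /eff_routing; case: ifP => // _; rewrite addr_ge0 ?routing_ge0 //.
by apply: sumr_ge0 => l _; rewrite mulr_ge0 ?routing_ge0.
Qed.

Lemma sum_eff i : \sum_k eff i k = 1.
Proof.
rewrite (bigID inst) /= big1 ?add0r => [|k]; last exact: eff_inst.
under eq_bigr do rewrite eff_noninst //.
rewrite big_split exchange_big /= -[RHS](sum_routing i) [RHS](bigID inst) /= addrC.
congr (_ + _); apply: eq_bigr => l il; rewrite -mulr_sumr.
(* No instantaneous node leads to another one, so skipping it loses no mass. *)
suff -> : \sum_(k | ~~ inst k) routing rho l k = 1 by rewrite mulr1.
rewrite -[RHS](sum_routing l) [RHS](bigID inst) /= [X in _ = X + _]big1 ?add0r // => k.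
exact: routing_inst.
Qed.

(** Substituting the traffic equations of the instantaneous nodes into that of [k] eliminates them
    and leaves the other visit ratios unchanged. *)
Lemma eff_traffic k : ~~ inst k ->
  \sum_(i | ~~ inst i) visit i * eff i k = visit k.
Proof.
move=> kn; under eq_bigr do rewrite eff_noninst // mulrDr mulr_sumr.
rewrite big_split exchange_big /= -[RHS]traffic [RHS](bigID inst) /= addrC.
congr (_ + _); apply: eq_bigr => l il.
under eq_bigr do rewrite mulrA.
rewrite -mulr_suml; congr (_ * _).
rewrite -[RHS]traffic [RHS](bigID inst) /= [X in _ = X + _]big1 ?add0r // => i ii.
by rewrite routing_inst // mulr0.
Qed.

(** * Global balance for the product weights *)

Section Population.
Variable N : nat.
Implicit Types n m : state K N.
Notation jump := (@jump_rate R K mu s rho tau N).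

Definition weight n : R := \prod_i node_weight i (pop n i).

Definition partition_function : R := \sum_n weight n.

Definition feasible n : bool := [forall i, inst i ==> (pop n i == 0%N)].

Lemma feasibleP n : reflect (forall i, inst i -> pop n i = 0%N) (feasible n).
Proof.
by apply: (iffP forallP) => h i; [move=> ii; have /implyP/(_ ii)/eqP := h i
  |apply/implyP => ii; rewrite h].
Qed.

Lemma weight_ge0 n : 0 <= weight n.
Proof. by apply: prodr_ge0 => i _; exact: node_weight_ge0. Qed.

Lemma weight_gt0 n : feasible n -> 0 < weight n.
Proof.
move=> /feasibleP h; apply: prodr_gt0 => i _.
have [ii|ii] := boolP (inst i); first by rewrite h // node_weight0.
exact: node_weight_gt0.
Qed.

Lemma weight_inst n i : inst i -> (0 < pop n i)%N -> weight n = 0.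
Proof. by move=> ii ni; rewrite /weight (bigD1 i) //= node_weight_inst // mul0r. Qed.

(** The product on the right is the weight of [n - e_i], whose total is one less, so that it is not
    a [state K N]. *)
Lemma weight_rate n i : ~~ inst i -> (0 < pop n i)%N ->
  weight n * rate i (pop n i) =
  visit i * \prod_l node_weight l (pop n l - (l == i)).
Proof.
move=> ii ni; rewrite /weight (bigD1 i) //= [in RHS](bigD1 i) //= eqxx subn1.
rewrite mulrAC mulrA -[in LHS](prednK ni) node_weightS //.
congr (_ * _); apply: eq_bigr => l /negbTE ->.
by rewrite subn0.
Qed.

(** Both sides reduce to the weight of the common remainder [n - e_i = m - e_k]. *)
Lemma weight_move n m i k : is_move n m i k -> ~~ inst i -> ~~ inst k ->
  weight m * rate k (pop m k) * visit i = visit k * (weight n * rate i (pop n i)).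
Proof.
move=> mv ii ik; have := mv; rewrite is_move_sym => mv'.
have mk : (0 < pop m k)%N.
  have /is_moveP[ni h] := mv; have := h k; rewrite eqxx.
  by case: eqP => [->|_]; lia.
have /is_moveP[ni h] := mv.
rewrite weight_rate // [in RHS]weight_rate // mulrAC mulrA; congr (_ * _).
apply: eq_bigr => l _; congr node_weight.
by have := h l; case: (l == i); case: (l == k) => /=; lia.
Qed.

Lemma out_rate n : \sum_m jump n m = \sum_i rate i (pop n i).
Proof.
rewrite /jump_rate exchange_big /=; apply: eq_bigr => i _.
under eq_bigr do rewrite big_mkcond.
rewrite exchange_big /=.
rewrite -[RHS]mulr1 -(sum_eff i) mulr_sumr; apply: eq_bigr => k _.
rewrite -big_mkcond sum_is_move; case: ltnP => //.
by rewrite leqn0 => /eqP ->; rewrite rate0 mul0r.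
Qed.

(** Partial balance: for each node [k], the flow into [n] by arrivals at [k] equals the flow out of
    [n] by departures from [k], thanks to [eff_traffic]. *)
Lemma weight_balance n :
  weight n * (\sum_m jump n m) = \sum_m weight m * jump m n.
Proof.
rewrite out_rate /jump_rate.
(* The inflow is grouped by the node [k] that the truck enters; [m] is [n - e_k + e_i], and
   [weight_move] expresses its flow through [weight n]. *)
transitivity (\sum_k \sum_i \sum_(m | is_move n m k i)
   if inst i then 0 else
   visit i * eff i k / visit k * (weight n * rate k (pop n k))); last first.
  under [RHS]eq_bigr do rewrite mulr_sumr.
  rewrite exchange_big [RHS]exchange_big /=; apply: eq_bigr => i _.
  under [RHS]eq_bigr do rewrite mulr_sumr big_mkcond.
  rewrite [RHS]exchange_big /=; apply: eq_bigr => k _.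
  rewrite big_mkcond; apply: eq_bigr => m _; rewrite [in RHS]is_move_sym.
  case: ifP => // mv; case: ifPn => [ii|ii]; first by rewrite rate_inst // mul0r mulr0.
  have [ik|ik] := boolP (inst k); first by rewrite eff_inst // !(mul0r, mulr0).
  have E := weight_move mv ik ii; have vk0 : visit k != 0 by rewrite gt_eqF ?visit_gt0.
  rewrite [in RHS]mulrA -[X in _ = X * _](mulfK vk0) E; ring.
rewrite mulr_sumr; apply: eq_bigr => k _.
under [RHS]eq_bigr do rewrite sum_is_move.
case: ltnP => [nk|]; last first.
  by rewrite leqn0 => /eqP ->; rewrite rate0 mulr0 big1_eq.
have [ik|ik] := boolP (inst k).
  by rewrite rate_inst // mulr0 big1 // => i _; rewrite mulr0; case: ifP.
have vk0 : visit k != 0 by rewrite gt_eqF ?visit_gt0.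
rewrite (eq_bigr (fun i => if ~~ inst i then
   visit i * eff i k / visit k * (weight n * rate k (pop n k)) else 0)); last first.
  by move=> i _; case: ifP.
by rewrite -big_mkcond -!mulr_suml eff_traffic // divff // mul1r.
Qed.

(** * Uniqueness of the stationary distribution *)

Lemma jump_ge0 n m : 0 <= jump n m.
Proof.
by do 2![apply: sumr_ge0 => ? _]; rewrite mulr_ge0 ?rate_ge0 ?eff_ge0.
Qed.

Lemma jump_gt0 n m i k : is_move n m i k -> ~~ inst i -> 0 < eff i k ->
  0 < jump n m.
Proof.
move=> mv ii e0; rewrite /jump_rate (bigD1 i) //= (bigD1 k) //=.
have /is_moveP[ni _] := mv.
rewrite -addrA ltr_pwDl ?mulr_gt0 ?rate_gt0 // addr_ge0 //.
  by apply: sumr_ge0 => l _; rewrite mulr_ge0 ?rate_ge0 ?eff_ge0.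
by do 2![apply: sumr_ge0 => ? _]; rewrite mulr_ge0 ?rate_ge0 ?eff_ge0.
Qed.

(** Position along the round trip from the center. The induced [potential] is the measure for
    walking jumps backwards to the state with all trucks at the center. *)
Definition depth (i : node K) : nat :=
  match i with
  | Station _ => if i == center then 0 else 2
  | Out _ => 1
  | Back _ => 3
  end.

Definition potential n : nat := (\sum_i depth i * pop n i)%N.

Lemma eff_predecessor k : ~~ inst k -> k != center ->
  exists i, [/\ ~~ inst i, 0 < eff i k & (depth i < depth k)%N].
Proof.
have effr i l : ~~ inst l -> 0 < routing rho i l -> 0 < eff i l.
  move=> il r0; rewrite eff_noninst // ltr_pwDl //; apply: sumr_ge0 => ? _.
  by rewrite mulr_ge0 ?routing_ge0.
case: k => [k|j|j] ik.
- case: (unliftP ord0 k) ik => [j|] -> ik //= _.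
  have [tj|tj] := boolP (inst (Out j)); last first.
    exists (Out j); split=> //; apply: effr => //=; first by rewrite eqxx ltr01.
  (* With [Out j] instantaneous, the warehouse is reached straight from the center through the
     skipping term of [eff]. *)
  exists center; split=> //; rewrite eff_noninst // ltr_wpDl ?routing_ge0 //.
  rewrite (bigD1 (Out j) tj) ltr_pwDl //; first by rewrite /= eqxx mulr1.
  by apply: sumr_ge0 => ? _; rewrite mulr_ge0 ?routing_ge0.
- by move=> _; exists center; split=> //; apply: effr => /=.
- move=> _; exists (warehouse j); split=> //; apply: effr => //=.
  by rewrite eqxx ltr01.
Qed.

Lemma predecessor n k : feasible n -> k != center -> (0 < pop n k)%N ->
  exists m, [/\ feasible m, 0 < jump m n & (potential m < potential n)%N].
Proof.
move=> /feasibleP fn kc nk.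
have ik : ~~ inst k by apply/negP => ik; rewrite fn in nk.
have [i [ii e0 dik]] := eff_predecessor ik kc.
have [m mv] := is_move_exists i nk.
have /is_moveP[_ h] := mv.
exists m; split.
- apply/feasibleP => l il; have := h l; rewrite fn //.
  by case: (l =P i) => [li|_]; [rewrite li (negbTE ii) in il|rewrite add0n => /eqP;
    rewrite addn_eq0 => /andP[/eqP]].
- by apply: (@jump_gt0 _ _ i k) => //; rewrite is_move_sym.
- have : (potential m + depth k = potential n + depth i)%N.
    have sd (j : node K) : (depth j = \sum_l depth l * (l == j))%N.
      by rewrite (bigD1 j) //= eqxx muln1 big1 ?addn0 // => l /negbTE ->; rewrite muln0.
    rewrite (sd k) (sd i) -!big_split /=; apply: eq_bigr => l _.
    by rewrite -!mulnDr h.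
  lia.
Qed.

Definition balanced (r : state K N -> R) : Prop :=
  forall n, r n * (\sum_m jump n m) = \sum_m r m * jump m n.

Lemma balancedB r r' c : balanced r -> balanced r' ->
  balanced (fun n => r n - c * r' n).
Proof.
move=> b b' n; rewrite mulrBl b -mulrA b' mulr_sumr -sumrB.
by apply: eq_bigr => m _; rewrite mulrBl mulrA.
Qed.

(** At a zero of [r], balance makes a sum of nonnegative inflows vanish, so [r] vanishes at every
    predecessor. Induction on the potential leads back to [c0]. *)
Lemma zero_at_center r n0 c0 : balanced r -> (forall n, 0 <= r n) ->
  (forall i, pop c0 i = if i == center then N else 0%N) ->
  feasible n0 -> r n0 = 0 -> r c0 = 0.
Proof.
move=> br r0 c0E.
have [p] := ubnP (potential n0); elim: p n0 => // p IHp n pn fn rn.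
have [/existsP[k /andP[kc nk]]|no] := boolP [exists k, (k != center) && (0 < pop n k)%N].
  have [m [fm jm pm]] := predecessor fn kc nk.
  apply: (IHp m) => //; first by rewrite (leq_trans pm).
  have /esym/eqP := br n; rewrite rn mul0r psumr_eq0 => [|l _]; last first.
    by rewrite mulr_ge0 ?jump_ge0.
  move=> /allP/(_ m); rewrite mem_index_enum => /(_ isT) /=.
  by rewrite mulf_eq0 (gt_eqF jm) orbF => /eqP.
suff -> : c0 = n by [].
have nz i : i != center -> pop n i = 0%N.
  move=> ic; apply/eqP; rewrite -leqn0 leqNgt; apply: contra no => ni.
  by apply/existsP; exists i; rewrite ic.
apply: pop_inj => i; rewrite c0E; case: eqP => [->|/eqP/nz//].
by rewrite pop_center_eq.
Qed.

(* The argument n minimising r / weight gives r - t weight >= 0 with a zero,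
   and the zero set of a nonnegative solution is closed under predecessors. *)
Lemma balanced_ge0 r c0 : balanced r ->
  (forall n, ~~ feasible n -> r n = 0) ->
  (forall i, pop c0 i = if i == center then N else 0%N) ->
  r c0 = 0 -> forall n, 0 <= r n.
Proof.
move=> br rf c0E rc0.
have wf n : ~~ feasible n -> weight n = 0.
  rewrite negb_forall => /existsP[i]; rewrite negb_imply -lt0n => /andP[ii ni].
  exact: weight_inst ni.
have fc0 : feasible c0.
  by apply/feasibleP => i ii; rewrite c0E; case: eqP ii => // ->.
have [n1 fn1 min1] := @arg_minP _ _ _ c0 feasible (fun n => r n / weight n) fc0.
set t := r n1 / weight n1 in min1.
have ge n : 0 <= r n - t * weight n.
  have [fn|fn] := boolP (feasible n); last by rewrite rf // wf // mulr0 subr0.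
  by rewrite subr_ge0 -ler_pdivlMr ?weight_gt0 ?min1.
have : r c0 - t * weight c0 = 0.
  apply: (@zero_at_center (fun n => r n - t * weight n) n1) => //.
    exact/balancedB/weight_balance.
  by rewrite /t divfK ?subrr // gt_eqF ?weight_gt0.
(* As [r c0 = 0] and [weight c0 > 0], this zero forces [t = 0], and [ge] becomes the claim. *)
rewrite rc0 sub0r => /eqP; rewrite oppr_eq0 mulf_eq0 (gt_eqF (weight_gt0 fc0)) orbF.
by move=> /eqP t0 n; have := ge n; rewrite t0 mul0r subr0.
Qed.

Lemma partition_function_gt0 : 0 < partition_function.
Proof.
have [c0 c0E] := all_at_center_exists K N.
rewrite /partition_function (bigD1 c0) //= ltr_pwDl ?sumr_ge0 //.
  by apply: weight_gt0; apply/feasibleP => i ii; rewrite c0E; case: eqP ii => // ->.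
by move=> n _; exact: weight_ge0.
Qed.

Lemma stationary_weight :
  stationary mu s rho tau [ffun n => weight n / partition_function].
Proof.
have G0 := partition_function_gt0; split=> [n||n i ii ni|n].
- by rewrite ffunE divr_ge0 ?weight_ge0 // ltW.
- under eq_bigr do rewrite ffunE.
  by rewrite -mulr_suml divff // gt_eqF.
- by rewrite ffunE (weight_inst ii ni) mul0r.
- rewrite ffunE mulrAC weight_balance mulr_suml; apply: eq_bigr => m _.
  by rewrite ffunE mulrAC.
Qed.

(** With [c] chosen so that [p - c * weight] vanishes at [c0], [balanced_ge0] applies to this
    difference and to its opposite, so it is zero; normalisation fixes [c]. *)
Lemma stationary_unique p : stationary mu s rho tau p ->
  p = [ffun n => weight n / partition_function] :> {ffun state K N -> R}.
Proof.
move=> [p0 p1 pinst pb]; have [c0 c0E] := all_at_center_exists K N.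
have fc0 : feasible c0.
  by apply/feasibleP => i ii; rewrite c0E; case: eqP ii => // ->.
have wc0 : weight c0 != 0 by rewrite gt_eqF ?weight_gt0.
have bad n : ~~ feasible n -> p n = 0 /\ weight n = 0.
  rewrite negb_forall => /existsP[i]; rewrite negb_imply -lt0n => /andP[ii ni].
  by split; [exact: pinst ni | exact: weight_inst ni].
set c := p c0 / weight c0.
have pE n : p n = c * weight n.
  apply/eqP; rewrite -subr_eq0 eq_le; apply/andP; split.
    (* The opposite is written in this shape to match [balancedB] with the zero function. *)
    pose r n := 0 - 1 * (p n - c * weight n).
    suff : 0 <= r n by rewrite /r sub0r mul1r oppr_ge0.
    apply: (@balanced_ge0 r c0) => // [|m /bad[pm wm]|].
    - apply: balancedB; first by move=> m; rewrite mul0r big1 // => *; rewrite mul0r.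
      exact/balancedB/weight_balance.
    - by rewrite /r pm wm mulr0 subrr mulr0 subrr.
    - by rewrite /r /c divfK // subrr mulr0 subrr.
  apply: (@balanced_ge0 (fun n => p n - c * weight n) c0) => // [|m /bad[pm wm]|].
  - exact/balancedB/weight_balance.
  - by rewrite pm wm mulr0 subrr.
  - by rewrite /c divfK // subrr.
have cG : c * partition_function = 1.
  by rewrite -p1 /partition_function mulr_sumr; apply: eq_bigr => n _; rewrite pE.
apply/ffunP => n; rewrite ffunE pE mulrC; congr (_ * _).
have G0 : partition_function != 0 by rewrite gt_eqF ?partition_function_gt0.
by apply: (mulIf G0); rewrite cG mulVf.
Qed.

Lemma stat_distE n : stat_dist mu s rho tau N n = weight n / partition_function.
Proof.
rewrite /stat_dist (xget_unique _ stationary_weight) ?ffunE //.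
by move=> p; exact: stationary_unique.
Qed.

End Population.

(** * Throughput and passage times *)

Definition node_poly (M : nat) (i : node K) : {poly R} :=
  \poly_(k < M) node_weight i k.

Lemma partition_functionE M N : (N < M)%N ->
  partition_function N = (\prod_i node_poly M i)`_N.
Proof.
move=> NM; apply: sum_state_coef => i k kN.
by rewrite coef_poly (leq_ltn_trans kN NM).
Qed.

(** Multiplying by the service rate at [i] cancels the last factor of the node weight, so the series
    of node [i] is multiplied by [visit i *: 'X]; the shift by ['X] yields the partition function of
    one truck less. *)
Lemma mean_serviceE N i : mean_service mu s rho tau N.+1 i =
  if inst i then 0
  else visit i * (partition_function N / partition_function N.+1).
Proof.
rewrite /mean_service; case: ifPn => ii.
  by apply: big1 => n _; rewrite rate_inst ?mulr0.
under eq_bigr do rewrite stat_distE mulrAC.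
rewrite -mulr_suml mulrA; congr (_ / _).
pose psi l k := if l == i then (if k is k'.+1 then visit i * node_weight i k' else 0)
                else node_weight l k.
rewrite (eq_bigr (fun n : state K N.+1 => \prod_l psi l (pop n l))); last first.
  move=> n _; rewrite /weight (bigD1 i) //= [RHS](bigD1 i) //= mulrAC.
  rewrite {1}/psi eqxx; congr (_ * _).
    by case: (pop n i) => [|k]; rewrite ?rate0 ?mulr0 ?node_weightS.
  by apply: eq_bigr => l /negbTE li; rewrite /psi li.
rewrite (@sum_state_coef _ _ _ _
  (fun l => if l == i then visit i *: ('X * node_poly N.+2 i) else node_poly N.+2 l)).
  rewrite (bigD1 i) //= eqxx (@partition_functionE N.+2) //.
  rewrite -scalerAl coefZ -mulrA coefXM /= [in RHS](bigD1 i) //=.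
  congr (_ * nth 0 (polyseq (_ * _)) _).
  by apply: eq_bigr => l /negbTE ->.
move=> l k kN; rewrite /psi; case: eqP => _.
  by rewrite coefZ coefXM; case: k kN => [|k] kN; rewrite ?mulr0 ?coef_poly //= ltnS (ltnW kN).
by rewrite coef_poly ltnS kN.
Qed.

(** At an instantaneous node the inflow is evaluated by its traffic equation, which gives the same
    formula as elsewhere. *)
Lemma departure_rateE N i : departure_rate mu s rho tau N.+1 i =
  visit i * (partition_function N / partition_function N.+1).
Proof.
rewrite /departure_rate; case: ifPn => ii; last by rewrite mean_serviceE (negbTE ii).
rewrite -traffic mulr_suml [RHS](bigID inst) /= [X in _ = X + _]big1 ?add0r => [|k ik].
  by apply: eq_bigr => k /negbTE ik; rewrite mean_serviceE ik mulrAC.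
by rewrite routing_inst // mulr0 mul0r.
Qed.

Lemma sum_mean_pop N : \sum_i mean_pop mu s rho tau N i = N%:R.
Proof.
rewrite /mean_pop exchange_big /=.
under eq_bigr do rewrite -mulr_sumr -natr_sum sum_pop stat_distE.
by rewrite -!mulr_suml divff ?mul1r // gt_eqF ?partition_function_gt0.
Qed.

(** The weights [rho j] cancel the visit ratios on each branch and sum to 1 at the center, so the
    passage time is the total mean population divided by the throughput [lam] of the center. *)
Lemma passage_timeE N : passage_time mu s rho tau N.+1 =
  N.+1%:R * (partition_function N.+1 / partition_function N).
Proof.
set lam := partition_function N / partition_function N.+1.
have G0 n : partition_function n != 0 by rewrite gt_eqF ?partition_function_gt0.
have lam0 : lam != 0 by rewrite mulf_neq0 ?invr_eq0.
have -> : partition_function N.+1 / partition_function N = lam^-1 by rewrite invf_div.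
rewrite -(sum_mean_pop N.+1) big_node big_ord_recl /=.
rewrite /passage_time (eq_bigr (fun j =>
    rho j * (mean_pop mu s rho tau N.+1 center / lam) +
    mean_pop mu s rho tau N.+1 (warehouse j) / lam +
    mean_pop mu s rho tau N.+1 (Out j) / lam +
    mean_pop mu s rho tau N.+1 (Back j) / lam)).
  by rewrite !big_split /= -!mulr_suml sum_rho mul1r -!mulrDl.
move=> j _; have rj : rho j != 0 by rewrite gt_eqF.
rewrite /passage_via /sojourn !departure_rateE -/lam visit_center visit_warehouse.
by rewrite /=; field; rewrite rj lam0.
Qed.

(** * Dependence on the travel times *)

Definition station_poly (M : nat) : {poly R} :=
  \prod_(k < K.+1) node_poly M (Station k).

(** Service rates are nondecreasing in the population; at an instantaneous node both sides are 0. *)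
Lemma node_weight_mono i a b : (a <= b)%N ->
  visit i / rate i b.+1 <= visit i / rate i a.+1.
Proof.
move=> ab; have [ii|ii] := boolP (inst i); first by rewrite !rate_inst.
rewrite ler_wpM2l ?(ltW (visit_gt0 i)) // lef_pV2 ?posrE ?rate_gt0 //.
case: i ii => [k|j|j] /= ii.
- by rewrite ler_wpM2l ?(ltW (mu_gt0 k)) // ler_nat leq_min !geq_min !leqnn orbT ltnS ab.
- by rewrite ler_wpM2r ?invr_ge0 ?ler_nat.
- by rewrite ler_wpM2r ?invr_ge0 ?ler_nat.
Qed.

Lemma station_poly_log_concave M : log_concave (station_poly M).
Proof.
apply: log_concave_prod => k.
apply: (@log_concave_poly_prod _ M (fun n => visit (Station k) / rate (Station k) n.+1)).
  by move=> n; rewrite divr_ge0 ?rate_ge0 ?ltW ?visit_gt0.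
exact: node_weight_mono.
Qed.

(** An infinite-server node has Poisson weights. The case [tau j = 0] is included, since inverting
    [i.+1 / 0 = 0] gives 0 again. *)
Lemma travel_poly M j :
  (node_poly M (Out j) = exp_poly M (rho j * tau j)) *
  (node_poly M (Back j) = exp_poly M (rho j * tau j)).
Proof.
suff E k : \prod_(i < k) (rho j / (i.+1%:R / tau j)) = (rho j * tau j) ^+ k / k`!%:R.
  by split; apply/polyP => k; rewrite !coef_poly -E.
rewrite fact_prod big_add1 big_mkord natr_prod -prodfV -[in X in _ ^+ X](card_ord k).
rewrite -prodr_const -big_split; apply: eq_bigr => i _ /=.
by rewrite invf_div mulrA.
Qed.

Lemma partition_function_exp M N : (N < M)%N -> partition_function N =
  (station_poly M * exp_poly M (2 * \sum_j rho j * tau j))`_N.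
Proof.
move=> NM; rewrite (partition_functionE NM) big_node /= -mulrA.
suff h : eq_upto M (\prod_j node_poly M (Out j) * \prod_j node_poly M (Back j))
                   (exp_poly M (2 * \sum_j rho j * tau j)).
  exact: (eq_uptoM (@eq_upto_refl _ _ _) h).
have eO : eq_upto M (\prod_j node_poly M (Out j)) (exp_poly M (\sum_j rho j * tau j)).
  by rewrite (eq_bigr _ (fun j _ => (travel_poly M j).1)); exact: exp_poly_prod.
have eB : eq_upto M (\prod_j node_poly M (Back j)) (exp_poly M (\sum_j rho j * tau j)).
  by rewrite (eq_bigr _ (fun j _ => (travel_poly M j).2)); exact: exp_poly_prod.
(* The factor 2 comes from the outward and the return leg. *)
rewrite mulr_natl mulr2n; apply: eq_upto_trans (@exp_polyD _ _ _ _).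
exact: eq_uptoM.
Qed.

End Network.

Lemma passage_time_mono (R : realType) (K : nat) (mu : 'I_K.+1 -> R)
    (s : 'I_K.+1 -> nat) (rho tau tau' : 'I_K -> R) (N : nat) :
  (forall k, 0 < mu k) -> (forall k, (0 < s k)%N) ->
  (forall j, 0 < rho j) -> \sum_j rho j = 1 ->
  (forall j, 0 <= tau j) -> (forall j, 0 <= tau' j) ->
  \sum_j rho j * tau j <= \sum_j rho j * tau' j ->
  passage_time mu s rho tau N.+1 <= passage_time mu s rho tau' N.+1.
Proof.
move=> mu0 s0 rho0 rho1 t0 t0' tt'.
rewrite !passage_timeE // ler_wpM2l // ler_pdivrMr ?partition_function_gt0 //.
rewrite mulrAC ler_pdivlMr ?partition_function_gt0 //.
(* The truncation order [N.+2] keeps both coefficients [N] and [N.+1] exact. *)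
rewrite !(@partition_function_exp _ _ mu s rho _ N.+2) //.
(* Visit ratios and service rates at stations do not involve travel times, so the two are
   convertible. *)
have -> : station_poly mu s rho tau' N.+2 = station_poly mu s rho tau N.+2 by [].
rewrite mulrC; apply: exp_poly_ratio_mono => //.
- exact: station_poly_log_concave.
- by rewrite mulr_ge0 // sumr_ge0 // => j _; rewrite mulr_ge0 ?(ltW (rho0 j)).
- by rewrite ler_wpM2l.
Qed.

Theorem mainTheorem4 (R : realType) (K : nat) (K_gt0 : (0 < K)%N)
  (a : 'I_K -> 'rV[R]_2)
  (D : 'I_K -> R) (D_gt0 : forall j, 0 < D j)
  (d : 'rV[R]_2 -> 'rV[R]_2 -> R)
  (d_ge0 : forall y x, 0 <= d y x)
  (d_convex : @convex_function R ('rV[R]_2 * 'rV[R]_2)%type setT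
                (fun yx => d yx.1 yx.2))
  (s : 'I_K.+1 -> nat) (s_ge1 : forall k, (1 <= s k)%N)
  (mu : 'I_K.+1 -> R) (mu_gt0 : forall k, 0 < mu k)
  (xstar : 'rV[R]_2)
  (weber : forall x, weber_cost D a d xstar <= weber_cost D a d x)
  (N : nat) (N_ge1 : (1 <= N)%N) :
  forall x : 'rV[R]_2,
    overall_passage_time D a d mu s N xstar <= overall_passage_time D a d mu s N x.
Proof.
move=> x; have D0 : 0 < \sum_j D j.
  case: K K_gt0 D D_gt0 {a s s_ge1 mu mu_gt0 weber} => // K _ D D_gt0.
  by rewrite big_ord_recl ltr_pwDl // sumr_ge0 // => j _; exact: ltW.
rewrite /overall_passage_time -(prednK N_ge1).
(* The Weber hypothesis is exactly the required comparison of the weighted mean travel times at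
   [xstar] and [x]. *)
apply: passage_time_mono => // [j||]; last exact: weber.
  by rewrite divr_gt0.
by rewrite -mulr_suml divff // gt_eqF.
Qed.
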